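(* Let $\Gamma$ be a metrically homogeneous graph of generic type, of diameter $\delta$, and let $\sigma$ be a non-trivial permutation of the language of $\Gamma$ such that $\Gamma^\sigma$ is itself a metrically homogeneous graph. Then $\sigma$ is one of the permutations $\rho,\rho^{-1},\tau_0,\tau_1$ of $\{1,\dots,\delta\}$ (in particular $\delta$ is finite, as these definitions require), which are defined as follows: $$\rho(i)=\begin{cases}2i & i\le\delta/2\\ 2(\delta-i)+1 & i>\delta/2\end{cases}\qquad \rho^{-1}(i)=\begin{cases} i/2 & i\text{ even}\\ \delta-\frac{i-1}{2} & i\text{ odd}\end{cases}$$ and, for $\epsilon\in\{0,1\}$, $\tau_\epsilon$ is the involution $$\tau_\epsilon(i)=\begin{cases}(\delta+\epsilon)-i & \text{if }\min(i,(\delta+\epsilon)-i)\text{ is odd}\\ i & \text{otherwise.}\end{cases}$$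
   Context: A connected graph $\Gamma$ is viewed as a metric space under its path metric $d$. It is a metrically homogeneous graph if every isometry between finite subspaces of $\Gamma$ extends to an isometry of $\Gamma$ onto itself. Let $\delta\le\infty$ be its diameter. The language of $\Gamma$ consists of binary relations $R_i$ ($i$ a positive integer, $i\le\delta$), with $R_i(u,v)$ iff $d(u,v)=i$; a permutation $\sigma$ of the language is identified with a permutation of the set of positive integers $i\le\delta$, and is non-trivial if it is not the identity. $\Gamma^\sigma$ is the structure on the same vertex set with $d^\sigma(u,v)=\sigma(d(u,v))$ for $u\ne v$ (and $d^\sigma(u,u)=0$). Saying that $\Gamma^\sigma$ is a metrically homogeneous graph means that the graph with edge relation $d^\sigma(u,v)=1$ is connected, that $d^\sigma$ is its path metric, and that this graph is metrically homogeneous. $\Gamma_1$ denotes the set of neighbors of a fixed basepoint, with the induced metric. $\Gamma$ is of generic type if any two vertices at distance $2$ have infinitely many common neighbors, among which there is an infinite independent set, and $\Gamma_1$ admits no non-trivial $\mathrm{Aut}(\Gamma_1)$-invariant equivalence relation (i.e. none other than equality and the universal relation). *)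

(* Defs.v *)
From mathcomp Require Import all_boot.
From mathcomp Require Import boolp classical_sets functions cardinality.

Set Implicit Arguments.
Unset Strict Implicit.
Unset Printing Implicit Defensive.

Local Open Scope classical_set_scope.

Section PathMetric.
Variables (V : eqType) (e : rel V).

Definition simple_graph := symmetric e /\ irreflexive e.

Definition walk (u v : V) (n : nat) :=
  exists p : seq V, [/\ path e u p, last u p = v & size p = n].

Definition connected_graph := forall u v, exists n, walk u v n.

(* The value is 0 by default when no walk joins u to v; this never happens in
   a connected graph. *)
Definition gdist (u v : V) : nat :=
  xget 0 [set n | walk u v n /\ forall m, walk u v m -> n <= m].

End PathMetric.

Section Isometries.
Variables (V : Type) (d : V -> V -> nat).

(* f is total, but only its restriction to A matters. *)
Definition isometry_between (A B : set V) (f : V -> V) :=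
  set_bij A B f /\ (forall x y, A x -> A y -> d (f x) (f y) = d x y).

Definition homogeneous_metric :=
  forall (A B : set V) (f : V -> V),
    finite_set A -> finite_set B -> isometry_between A B f ->
    exists g : V -> V,
      isometry_between setT setT g /\ (forall x, A x -> g x = f x).

(* Only the restriction of E to A matters. *)
Definition equivalence_on (A : set V) (E : V -> V -> Prop) :=
  [/\ forall x, A x -> E x x,
      forall x y, A x -> A y -> E x y -> E y x &
      forall x y z, A x -> A y -> A z -> E x y -> E y z -> E x z].

Definition invariant_on (A : set V) (E : V -> V -> Prop) :=
  forall g, isometry_between A A g ->
  forall x y, A x -> A y -> (E x y <-> E (g x) (g y)).

Definition primitive_on (A : set V) :=
  forall E : V -> V -> Prop, equivalence_on A E -> invariant_on A E ->
    (forall x y, A x -> A y -> E x y -> x = y) \/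
    (forall x y, A x -> A y -> E x y).

End Isometries.

Section MetricallyHomogeneousGraphs.
Variables (V : eqType) (e : rel V).

Definition metrically_homogeneous :=
  [/\ simple_graph e, connected_graph e & homogeneous_metric (gdist e)].

(* None stands for an infinite diameter. *)
Definition has_diameter (delta : option nat) :=
  match delta with
  | Some n => (forall u v, gdist e u v <= n) /\ (exists u v, gdist e u v = n)
  | None => forall n, exists u v, n < gdist e u v
  end.

Definition neighbors (x : V) : set V := [set y | e x y].

Definition independent (I : set V) := forall x y, I x -> I y -> ~~ e x y.

Definition generic_type (x0 : V) :=
  (forall u v, gdist e u v = 2 ->
     infinite_set (neighbors u `&` neighbors v) /\
     (exists I : set V, [/\ I `<=` neighbors u `&` neighbors v,
                            infinite_set I & independent I])) /\
  primitive_on (gdist e) (neighbors x0).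

Definition twist_dist (sigma : nat -> nat) (u v : V) : nat :=
  if u == v then 0 else sigma (gdist e u v).

Definition twist_edge (sigma : nat -> nat) : rel V :=
  fun u v => twist_dist sigma u v == 1.

End MetricallyHomogeneousGraphs.

Definition twist_metrically_homogeneous (V : eqType) (e : rel V)
    (sigma : nat -> nat) :=
  [/\ connected_graph (twist_edge e sigma),
      forall u v, twist_dist e sigma u v = gdist (twist_edge e sigma) u v &
      metrically_homogeneous (twist_edge e sigma)].

Definition language (delta : option nat) : set nat :=
  [set i | 0 < i /\ (if delta is Some n then i <= n : Prop else True)].

(* sigma : nat -> nat is only meaningful on the language. *)
Definition language_permutation (delta : option nat) (sigma : nat -> nat) :=
  set_bij (language delta) (language delta) sigma.

Definition nontrivial_on (delta : option nat) (sigma : nat -> nat) :=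
  exists i, language delta i /\ sigma i <> i.

Definition same_on (delta : option nat) (sigma sigma' : nat -> nat) :=
  forall i, language delta i -> sigma i = sigma' i.

(* For 1 <= i <= delta none of the subtractions below truncates and none of
   the halvings rounds. *)
Definition rho (delta i : nat) : nat :=
  if 2 * i <= delta then 2 * i else 2 * (delta - i) + 1.

Definition rho_inv (delta i : nat) : nat :=
  if odd i then delta - (i - 1) %/ 2 else i %/ 2.

Definition tau (epsilon delta i : nat) : nat :=
  if odd (minn i (delta + epsilon - i)) then delta + epsilon - i else i.

(* Main.v *)
Require Import Defs.
From mathcomp Require Import all_boot.
From mathcomp Require Import boolp classical_sets cardinality.
From mathcomp Require Import zify.

Set Implicit Arguments.
Unset Strict Implicit.
Unset Printing Implicit Defensive.

(** Write [s] for the permutation of the distances extended by [s 0 = 0], and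
    call the distance [a] with [s a = 1] the pivot: the edges of the twisted graph
    are the pairs at distance [a]. Call [x] and [y] tied when some triangle has
    distances [(a, x, y)]. Since the twisted distance is a path metric, [s]
    enumerates the distances as a chain [0, a, ...] whose consecutive members are
    tied, while tied distances are equal or consecutive in it; so no distance is
    tied to more than two others ([crowded]). The proof plays this sparsity
    against the triangles that have to exist.

    Geodesics tie [i] to [a - i] and to [a + i]. Generic type adds two families.
    Two vertices at distance [2] have two non-adjacent common neighbours, so
    [(i, i, 2)] is realized if [i + 1] is a distance ([realized_ii2]). And one of
    [(i, i + 1, 2)] and [(i, i + 1, 3)] is realized if [i + 2] is a distance
    ([realized_succ]), because otherwise any two vertices at distance [2] on a
    sphere would have the same neighbours on the preceding sphere, a property
    that descends to the sphere of radius [2] and fails there. Finally, ties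
    propagate: pushing a vertex one step outwards turns a tie of [i] into a tie
    of [i + 1] with nearly the same partner ([realized_step]).

    If [a >= 3] and [a + 2] is still a distance, then [2] is tied to [a - 2], [a]
    and [a + 2], hence to nothing else, and the second family ties [3], just like
    [1], to both [a - 1] and [a + 1]: a cycle, which a chain cannot contain
    ([not_inner_pivot]). So the diameter [n] is finite when [a >= 3], and [a] is
    [n - 1] or [n]. The pivot [1] gives the identity, and for [n <= 3] every
    permutation that moves [1] is listed. In the remaining cases propagation
    yields enough ties to determine the chain.
    - If [a = 2], the chain climbs through the even numbers and returns through
      the odd ones; without a bound on the distances it would never reach [1].
      The result is [rho_inv].
    - If [a = n - 1], then [i] is tied to [a - i] and [a + 2 - i], and [s] is
      [tau 0].
    - If [a = n] and [(n, n, 1)] is realized, then [i] is tied to [a - i] and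
      [a + 1 - i], and [s] is [rho].
    - If [a = n] and [(n, n, 1)] is not realized, then [1] is the end of the
      chain and [s] is [tau 1] as soon as [2] is tied to [n]; this is where the
      finer use of homogeneity in [not_realized_last] is needed. *)

(** * The path metric *)

Section PathMetric.
Variables (V : eqType) (e : rel V).

Lemma walk_cat u v w m n :
  walk e u v m -> walk e v w n -> walk e u w (m + n).
Proof.
move=> [p [pp lp <-]] [q [pq lq <-]]; exists (p ++ q).
by rewrite cat_path last_cat size_cat lp pp pq.
Qed.

Lemma walk_split u w m n :
  walk e u w (m + n) -> exists v, walk e u v m /\ walk e v w n.
Proof.
move=> [p [pp lp sp]]; exists (last u (take m p)).
move: pp lp; rewrite -{1 2}(cat_take_drop m p) cat_path last_cat.
move=> /andP[p1 p2] lp; split; [exists (take m p)|exists (drop m p)].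
  by rewrite size_takel // sp leq_addr.
by rewrite size_drop sp addKn.
Qed.

Lemma walk_rev u v n : symmetric e -> walk e u v n -> walk e v u n.
Proof.
move=> esym [p [pp <- <-]]; exists (rev (belast u p)); split.
- by rewrite rev_path (eq_path (e' := e)).
- by case: p pp => //= x p _; rewrite rev_cons last_rcons.
- by rewrite size_rev size_belast.
Qed.

Hypotheses (esimple : simple_graph e) (econn : connected_graph e).

Local Notation d := (gdist e).

Lemma gdistP u v : walk e u v (d u v) /\ forall n, walk e u v n -> d u v <= n.
Proof.
have [n0 w0] := econn u v.
have ex : exists n, `[< walk e u v n >] by exists n0; apply/asboolP.
apply: (@xgetPex _ 0
  [set n | walk e u v n /\ forall m, walk e u v m -> n <= m]%classic).
case: (ex_minnP ex) => n /asboolP wn nmin.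
by exists n; split=> // m wm; apply/nmin/asboolP.
Qed.

Lemma gdist_walk u v : walk e u v (d u v).
Proof. by have [] := gdistP u v. Qed.

Lemma gdist_min u v n : walk e u v n -> d u v <= n.
Proof. by have [_] := gdistP u v; apply. Qed.

Lemma gdistC u v : d u v = d v u.
Proof.
have [esym _] := esimple.
by apply/eqP; rewrite eqn_leq !gdist_min //; apply: walk_rev => //; apply: gdist_walk.
Qed.

Lemma gdist_eq0 u v : d u v = 0 -> u = v.
Proof. by move=> d0; have := gdist_walk u v; rewrite d0 => -[[|x p] []]. Qed.

Lemma gdistxx u : d u u = 0.
Proof. by apply/eqP; rewrite -leqn0 gdist_min //; exists [::]. Qed.

Lemma gdist_adj u v : d u v = 1 <-> e u v.
Proof.
have [_ eirr] := esimple; split.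
  move=> d1; have := gdist_walk u v; rewrite d1 => -[[|x [|y p]] []] //=.
  by rewrite andbT => + <-.
move=> uv; have : d u v <= 1 by apply: gdist_min; exists [:: v]; rewrite /= uv.
by case E: (d u v) => [|[|]] //; move: uv; rewrite (gdist_eq0 E) eirr.
Qed.

Lemma gdist_triangle u v w : d u w <= d u v + d v w.
Proof. by apply: gdist_min; apply: walk_cat (gdist_walk _ _) (gdist_walk _ _). Qed.

(** Everything that linear arithmetic needs to know about the distances between
    three points, whichever way round they are written. *)
Lemma gdist_triangles x y z :
  (d x y = d y x /\ d x z = d z x /\ d y z = d z y) /\
  (d x y <= d x z + d y z /\ d x z <= d x y + d y z /\
   d y z <= d x y + d x z).
Proof.
have := (gdist_triangle x z y, gdist_triangle x y z, gdist_triangle y x z).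
by rewrite (gdistC z y) (gdistC y x) => -[[-> ->] ->]; rewrite -!(gdistC z).
Qed.

Lemma gdist_split u w m n :
  d u w = m + n -> exists v, d u v = m /\ d v w = n.
Proof.
move=> dmn; have := gdist_walk u w; rewrite dmn => /walk_split[v [w1 w2]].
exists v; have := gdist_triangle u v w; move: (gdist_min w1) (gdist_min w2); lia.
Qed.

End PathMetric.

(** Degenerate triangles count, so that [(i, i, 0)] is realized. *)
Definition realized (V : eqType) (e : rel V) (i j k : nat) :=
  exists u v w, [/\ gdist e u v = i, gdist e u w = j & gdist e v w = k].

Definition occurs (V : eqType) (e : rel V) (i : nat) :=
  exists u v, gdist e u v = i.

(** * Consequences of metric homogeneity *)

Section Homogeneity.
Variables (V : eqType) (e : rel V).
Hypothesis ehom : metrically_homogeneous e.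

Local Notation d := (gdist e).
Local Notation T := (realized e).
Local Notation occ := (occurs e).

Let esimple : simple_graph e. Proof. by case: ehom. Qed.
Let econn : connected_graph e. Proof. by case: ehom. Qed.
Let dC := gdistC esimple econn.
Let d3 := gdist_triangles esimple econn.
Let dxx := gdistxx econn.

Lemma homogeneous_seq (x0 : V) (s t : seq V) :
  size s = size t ->
  (forall i j, i < size s -> j < size s ->
     d (nth x0 s i) (nth x0 s j) = d (nth x0 t i) (nth x0 t j)) ->
  exists g : V -> V, (forall x y, d (g x) (g y) = d x y) /\
    forall i, i < size s -> g (nth x0 s i) = nth x0 t i.
Proof.
move=> szst dst; have [_ _ hom] := ehom.
pose f x := nth x0 t (index x s).
have df x y : x \in s -> y \in s -> d (f x) (f y) = d x y.
  by move=> xs ys; rewrite -dst ?index_mem // !nth_index.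
(* Repeated entries of [s] are repeated in [t], being at distance [0]. *)
have fs i : i < size s -> f (nth x0 s i) = nth x0 t i.
  move=> lis; apply: (gdist_eq0 econn); rewrite /f -dst ?index_mem ?mem_nth //.
  by rewrite nth_index ?mem_nth.
pose A := [set x | x \in s]%classic; pose B := [set x | x \in t]%classic.
have [|g [[_ dg] gf]] := hom A B f (finite_seq s) (finite_seq t).
  split; last by move=> x y; apply: df.
  split.
  - by move=> x xs; rewrite /B /= mem_nth // -szst index_mem.
  - move=> x y /set_mem xs /set_mem ys fxy.
    by apply: (gdist_eq0 econn); rewrite -df // fxy.
  - move=> y /= yt; exists (nth x0 s (index y t)).
      by rewrite /A /= mem_nth // szst index_mem.
    by rewrite fs ?nth_index // szst index_mem.
exists g; split=> [x y|i lis]; first exact: dg.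
by rewrite gf ?fs // /A /= mem_nth.
Qed.

Lemma homogeneous4 (x1 x2 x3 x4 y1 y2 y3 y4 : V) :
  d x1 x2 = d y1 y2 -> d x1 x3 = d y1 y3 -> d x1 x4 = d y1 y4 ->
  d x2 x3 = d y2 y3 -> d x2 x4 = d y2 y4 -> d x3 x4 = d y3 y4 ->
  exists g : V -> V, (forall x y, d (g x) (g y) = d x y) /\
    [/\ g x1 = y1, g x2 = y2, g x3 = y3 & g x4 = y4].
Proof.
move=> d12 d13 d14 d23 d24 d34.
have [//||g [dg gi]] :=
  @homogeneous_seq x1 [:: x1; x2; x3; x4] [:: y1; y2; y3; y4].
  move=> [|[|[|[|i]]]] [|[|[|[|j]]]] //= _ _; rewrite ?dxx //;
  by rewrite dC 1?[RHS]dC.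
by exists g; split=> //; split; [apply: (gi 0)|apply: (gi 1)|apply: (gi 2)|apply: (gi 3)].
Qed.

Lemma homogeneous3 (x1 x2 x3 y1 y2 y3 : V) :
  d x1 x2 = d y1 y2 -> d x1 x3 = d y1 y3 -> d x2 x3 = d y2 y3 ->
  exists g : V -> V, (forall x y, d (g x) (g y) = d x y) /\
    [/\ g x1 = y1, g x2 = y2 & g x3 = y3].
Proof.
move=> d12 d13 d23.
have [||||||g [dg [g1 g2 g3 _]]] //:=
  @homogeneous4 x1 x2 x3 x3 y1 y2 y3 y3; first by rewrite !dxx.
by exists g.
Qed.

(** By homogeneity one triangle of a given type stands for all of them. *)
Lemma realized_extend i j k u v :
  T i j k -> d u v = i -> exists w, d u w = j /\ d v w = k.
Proof.
move=> [u' [v' [w' [duv duw dvw]]]] uv.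
have [|||g [dg [gu gv _]]] := @homogeneous3 u' v' v' u v v;
  rewrite ?duv ?uv ?dxx //.
by exists (g w'); rewrite -gu -gv !dg.
Qed.

Lemma realizedC12 i j k : T i j k -> T j i k.
Proof. by move=> [u [v [w [? ? <-]]]]; exists u, w, v; split=> //; apply: dC. Qed.

Lemma realizedC23 i j k : T i j k -> T i k j.
Proof. by move=> [u [v [w [? ? ?]]]]; exists v, u, w; split=> //; rewrite dC. Qed.

Lemma realized_triangle i j k :
  T i j k -> i <= j + k /\ j <= i + k /\ k <= i + j.
Proof. by move=> [u [v [w [<- <- <-]]]]; case: (d3 u v w). Qed.

Lemma realized_occurs i j k : T i j k -> [/\ occ i, occ j & occ k].
Proof.
by move=> [u [v [w [<- <- <-]]]]; split; [exists u, v|exists u, w|exists v, w].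
Qed.

Lemma occurs_le i j : i <= j -> occ j -> occ i.
Proof.
move=> ij [u [v duv]].
have [|w [duw _]] := @gdist_split _ _ econn u v i (j - i); first by lia.
by exists u, w.
Qed.

Lemma realized_geodesic i j : occ (i + j) -> T i (i + j) j.
Proof.
move=> [u [v duv]]; have [w [duw dwv]] := gdist_split econn duv.
by exists u, w, v.
Qed.

(** Move the third vertex of a triangle one step away from the first: its
    distance to the second changes by at most one. *)
Lemma realized_step a i k : T a i k -> occ i.+1 ->
  exists k', T a i.+1 k' /\ k.-1 <= k' <= k.+1.
Proof.
move=> [u [v [x [duv dux dvx]]]]; rewrite -addn1 => /realized_geodesic.
move=> /realized_extend /(_ dux) [y [duy dxy]].
exists (d v y); split; first by exists u, v, y.
by have := d3 v x y; lia.
Qed.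

End Homogeneity.

(** * Triangles forced by generic type *)

Section GenericType.
Variables (V : eqType) (e : rel V) (x0 : V).
Hypotheses (ehom : metrically_homogeneous e) (egen : generic_type e x0).

Local Notation d := (gdist e).
Local Notation T := (realized e).
Local Notation occ := (occurs e).

Let esimple : simple_graph e. Proof. by case: ehom. Qed.
Let econn : connected_graph e. Proof. by case: ehom. Qed.
Let dC := gdistC esimple econn.
Let d3 := gdist_triangles esimple econn.
Let ext := realized_extend ehom.

(** Taken from the infinite independent set of common neighbours. *)
Lemma common_neighbors u v : d u v = 2 -> exists x x',
  [/\ d u x = 1, d v x = 1, d u x' = 1, d v x' = 1 & d x x' = 2].
Proof.
move=> uv; have [/(_ _ _ uv)[_ [I [sI infI indI]]] _] := egen.
have [x Ix] := infinite_setN0 infI.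
have [x' [Ix' nx]] := infinite_setN0 (infinite_setD infI (finite_set1 x)).
have adj := gdist_adj esimple econn.
have [/adj ux /adj vx] := sI _ Ix; have [/adj ux' /adj vx'] := sI _ Ix'.
exists x, x'; split=> //.
have n1 : d x x' <> 1 by move=> /adj; apply/negP/indI.
have n0 : d x x' <> 0 by move=> /(gdist_eq0 econn) /esym.
by have := d3 u x x'; lia.
Qed.

(** Going two steps along a geodesic, the common neighbours of the ends of the
    second half all lie on the middle sphere. *)
Lemma realized_ii2 i : 0 < i -> occ i.+1 -> T i i 2.
Proof.
move=> i0 [v [q vq]]; have vq2 : d v q = i.-1 + 2 by lia.
have [z [vz zq]] := gdist_split econn vq2.
have [x [x' [zx qx zx' qx' xx']]] := common_neighbors zq.
have middle y : d z y = 1 -> d q y = 1 -> d v y = i.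
  by move=> zy qy; have := d3 v z y; have := d3 v q y; lia.
by exists v, x, x'; rewrite !middle.
Qed.

Definition twins i := forall v x x' u,
  d v x = i -> d v x' = i -> d x x' = 2 -> d v u = i.-1 -> d x u = 1 ->
  d x' u = 1.

(** If [u] and [u'] are non-adjacent common neighbours of [v] and [x], a neighbour
    [w] of [u] at distance [3] from [u'] is at distance [2] from [v] and [x], but
    [u'] tells it apart from [x]. *)
Lemma not_twins2 : occ 3 -> ~ twins 2.
Proof.
move=> occ3 tw; have T22 : T 2 2 2 by apply: realized_ii2.
have [v [x [_ [vx _ _]]]] := T22.
have [u [u' [vu xu vu' xu' uu']]] := common_neighbors vx.
have T213 : T 2 3 1 by apply: (@realized_geodesic _ _ ehom 2 1).
have [|w [u'w uw]] := ext T213 (_ : d u' u = 2); first by rewrite dC.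
have vw : d v w = 2 by have := d3 u v w; have := d3 v u' w; lia.
have xw : d x w = 2 by have := d3 u x w; have := d3 x u' w; lia.
by have := tw v x w u' vx vw xw vu' xu'; have := d3 w u' x; lia.
Qed.

(** The property descends: move the centre one step along a geodesic towards a
    vertex of the sphere. The geodesic passes through a neighbour of that vertex,
    which is also a neighbour of its twin, so that both are now one step closer
    to the centre. *)
Lemma not_twins i : 2 <= i -> occ i.+1 -> ~ twins i.
Proof.
elim: i => // i IHi; rewrite leq_eqVlt => /orP[/eqP[<-]|]; first exact: not_twins2.
rewrite ltnS => i2 occi2 tw; have occi1 : occ i.+1 by apply: occurs_le occi2.
apply: IHi => // v1 x x' u1 v1x v1x' xx' v1u1 xu1.
(* By homogeneity it suffices to treat [y] and [y'] seen from [v']. *)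
have [v [y [y' [vy vy' yy']]]] : T i.+1 i.+1 2 by apply: realized_ii2.
have [|v' [vv' v'y]] := @gdist_split _ _ econn v y 1 i; first by rewrite vy.
have [|u [v'u uy]] := @gdist_split _ _ econn v' y i.-1 1; first by lia.
have vu : d v u = i by have := d3 v v' u; have := d3 v u y; lia.
have y'u : d y' u = 1 by apply: (tw v y y' u) => //; rewrite dC.
have v'y' : d v' y' = i by have := d3 v' u y'; have := d3 v v' y'; lia.
have [|||g [dg [gv gx gx']]] := homogeneous3 ehom (_ : d v1 x = d v' y)
  (_ : d v1 x' = d v' y') (_ : d x x' = d y y'); rewrite ?v1x ?v1x' ?xx' //.
have yu : d y (g u1) = 1 by rewrite -gx dg.
have v'u1 : d v' (g u1) = i.-1 by rewrite -gv dg.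
have vu1 : d v (g u1) = i.
  by have := d3 v v' (g u1); have := d3 v y (g u1); lia.
by rewrite -dg gx'; apply: (tw v y).
Qed.

Lemma realized_succ i : 0 < i -> occ i.+2 -> T i i.+1 2 \/ T i i.+1 3.
Proof.
move=> i0 occi; apply: contrapT => noT.
apply: (@not_twins i.+1) => // v x x' u vx vx' xx' vu xu.
have Tu : T i i.+1 (d x' u) by exists v, u, x'; split=> //; apply: dC.
have n2 : d x' u <> 2 by move=> E; apply: noT; left; rewrite -E.
have n3 : d x' u <> 3 by move=> E; apply: noT; right; rewrite -E.
by have := d3 x x' u; have := d3 v x' u; lia.
Qed.

(** * Triangles on the last sphere *)

(** Fix [v]. Without the triangles [(n, n, 1)] and [(n, n, 2)] the neighbours of
    the last sphere lie on the sphere of radius [n.-1], and a vertex there has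
    exactly one neighbour on the last sphere, its apex. The triangle [(n, n.-1, 2)]
    would yield adjacent vertices [x1] and [x'] of radius [n.-1] with distinct apices
    [y] and [y']. By homogeneity any two adjacent vertices of radius [n.-1] have
    distinct apices, which leaves no triangle in the graph; and any two at
    distance [2] from each other have the same apex. Hence all neighbours of [x1]
    of radius [n.-1] have the apex [y'], and an isometry that fixes [v] and [x1]
    fixes [y']. But over [v], [y] and [x1] the other neighbours of [y] are
    indiscernible, whereas their distances to [y'] take the values [2] and [4]. *)
Lemma not_realized_last n : 4 <= n -> (forall u v, d u v <= n) ->
  ~ T n n 1 -> ~ T n n 2 -> ~ T n n.-1 2.
Proof.
move=> n4 dn no1 no2 [v [y [x' [vy vx' yx']]]].
have occn : occ n by exists v, y.
have last_dist a b : d v a = n -> d v b = n -> 0 < d a b -> 3 <= d a b.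
  move=> va vb ab.
  have ne1 : d a b <> 1 by move=> E; apply: no1; exists v, a, b.
  have ne2 : d a b <> 2 by move=> E; apply: no2; exists v, a, b.
  lia.
have below a b : d v a = n -> d a b = 1 -> d v b = n.-1.
  move=> va ab; have := last_dist a b va; have := dn v b; have := d3 v a b; lia.
have apex_unique a b x : d v a = n -> d v b = n -> d a x = 1 -> d b x = 1 -> a = b.
  move=> va vb ax bx; apply: (gdist_eq0 econn).
  by have := last_dist a b va vb; have := d3 a b x; lia.
have [x1 [x2 [yx1 x'x1 yx2 x'x2 x12]]] := common_neighbors yx'.
have vx1 := below _ _ vy yx1; have vx2 := below _ _ vy yx2.
have [y' [x'y' vy']] : exists y', d x' y' = 1 /\ d v y' = n.
  have Tn : T n.-1 1 n.
    apply: (realizedC23 ehom); have := @realized_geodesic _ _ ehom n.-1 1.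
    by rewrite addn1 prednK; [apply|lia].
  have [|w [x'w vw]] := ext Tn (_ : d x' v = n.-1); first by rewrite dC.
  by exists w.
have yy' : d y y' = 3.
  by have := last_dist y y' vy vy'; have := d3 y x' y'; lia.
have no_apex x w a : d v x = n.-1 -> d v w = n.-1 -> d x w = 1 ->
    d v a = n -> d x a = 1 -> d w a <> 1.
  move=> vx vw xw va xa.
  have [|||g [dg [gv gx gw]]] := homogeneous3 ehom (_ : d v x = d v x1)
    (_ : d v w = d v x') (_ : d x w = d x1 x');
    rewrite ?vx ?vw ?xw ?vx1 ?vx' //; first by rewrite dC.
  have ga : g a = y.
    have vga : d v (g a) = n by rewrite -gv dg.
    by apply: (apex_unique _ _ x1) => //; rewrite -gx dg dC.
  by rewrite -dg gw ga dC yx'.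
have no_triangle a b c : d a b = 1 -> d a c = 1 -> d b c <> 1.
  move=> ab ac bc; have T111 : T 1 1 1 by exists a, b, c.
  have [w [yw x1w]] := ext T111 yx1.
  apply: (no_apex x1 w y) => //; [exact: below vy yw|by rewrite dC..].
have same_apex x w a : d v x = n.-1 -> d v w = n.-1 -> d x w = 2 ->
    d v a = n -> d x a = 1 -> d w a = 1.
  move=> vx vw xw va xa.
  have [|||g [dg [gv gx gw]]] := homogeneous3 ehom (_ : d v x = d v x1)
    (_ : d v w = d v x2) (_ : d x w = d x1 x2);
    rewrite ?vx ?vw ?xw ?vx1 ?vx2 //.
  have ga : g a = y.
    have vga : d v (g a) = n by rewrite -gv dg.
    by apply: (apex_unique _ _ x1) => //; rewrite -gx dg dC.
  by rewrite -dg gw ga dC.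
have T314 : T 3 1 4.
  apply: (realizedC12 ehom); apply: (realizedC23 ehom).
  apply: (realized_geodesic ehom (i := 1) (j := 3)).
  exact: occurs_le occn.
have [z [yz y'z]] := ext T314 yy'.
have vz := below _ _ vy yz.
have x1y' : d x1 y' = 2 by have := d3 x1 x' y'; have := d3 y x1 y'; lia.
have x2y' : d x2 y' = 2 by have := d3 x2 x' y'; have := d3 y x2 y'; lia.
have x1z : d x1 z = 2.
  by have := no_triangle _ _ _ yx1 yz; have := d3 y x1 z; have := d3 y' x1 z; lia.
have [||||||g [dg [gv gy gx1 gx2]]] := homogeneous4 ehom (_ : d v y = d v y)
  (_ : d v x1 = d v x1) (_ : d v x2 = d v z) (_ : d y x1 = d y x1)
  (_ : d y x2 = d y z) (_ : d x1 x2 = d x1 z);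
  rewrite ?vx2 ?vz ?yx2 ?yz ?x12 ?x1z //.
(* [x'] and [g x'] are neighbours of [x1] of radius [n.-1]. *)
have gy' : g y' = y'.
  have vgy' : d v (g y') = n by rewrite -gv dg.
  have vgx' : d v (g x') = n.-1 by rewrite -gv dg.
  have gxy : d (g x') (g y') = 1 by rewrite dg.
  have x1gx' : d x1 (g x') = 1 by rewrite -gx1 dg dC.
  have x1x' : d x1 x' = 1 by rewrite dC.
  apply: (apex_unique _ _ (g x')) => //; first by rewrite dC.
  have ne1 := no_triangle _ _ _ x1x' x1gx'.
  have le2 : d x' (g x') <= 2 by have := d3 x1 x' (g x'); lia.
  case E : (d x' (g x')) ne1 le2 => [|[|[|k]]] // _ _.
  - by rewrite -(gdist_eq0 econn E) dC.
  - by rewrite dC; apply: (same_apex x').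
by move: (dg x2 y'); rewrite gx2 gy'; have := d3 y' z x2; lia.
Qed.

End GenericType.

(** * Labellings determined by their chains *)

Definition near (m n : nat) : Prop := m <= n.+1 /\ n <= m.+1.

(** The chain runs [0, a, 2, a - 2, 4, ...] from its start and
    [1, a - 1, 3, a - 3, ...] from its end. Each end determines its next member,
    because the labels on either side of the current one are spoken for; the two
    runs are followed together until they meet in the middle. *)
Lemma tau_labelling (s : nat -> nat) a :
  2 <= a -> s 0 = 0 -> s a = 1 -> s 1 = a ->
  (forall i j, i <= a -> j <= a -> i <> j -> s i <> s j) ->
  (forall i, i <= a -> s i <= a) ->
  (forall i, i <= a -> near (s i) (s (a - i))) ->
  (forall i, 2 <= i -> i.*2 <= a.+1 -> near (s i) (s (a.+2 - i))) ->
  forall i, 0 < i -> i.*2 <= a.+1 ->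
    if odd i then s i = a.+1 - i /\ s (a.+1 - i) = i
    else s i = i /\ s (a.+1 - i) = a.+1 - i.
Proof.
move=> a2 s0 sa s1 inj bnd lo hi; elim/ltn_ind => -[//|[|i]] IH _ ia.
  by rewrite subn1.
have IH1 := IH i.+1 (ltnSn _) isT ltac:(lia).
have near1 := hi i.+2 isT ia; have near2 := lo i.+1 ltac:(lia).
have e1 : a.+2 - i.+2 = a - i by lia.
have e2 : a - i.+1 = a.+1 - i.+2 by lia.
have e3 : a.+1 - i.+1 = a - i by lia.
rewrite e1 in near1; rewrite e2 in near2; rewrite e3 in IH1.
have b1 := bnd i.+2 ltac:(lia); have b2 := bnd (a.+1 - i.+2) ltac:(lia).
have i1 := inj i.+2 (a - i) ltac:(lia) ltac:(lia) ltac:(lia).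
have i2 := inj i.+2 i ltac:(lia) ltac:(lia) ltac:(lia).
have i3 := inj (a.+1 - i.+2) i.+1 ltac:(lia) ltac:(lia) ltac:(lia).
rewrite /near in near1 near2; have [i0|i0] := posnP i.
  subst i; move: IH1 => /=.
  by rewrite ?subn0 ?subn1 in i1 i2 i3 near1 near2 b2 *; split; lia.
have IH0 := IH i (leqnSn _) i0 ltac:(lia).
have i4 := inj (a.+1 - i.+2) (a.+1 - i) ltac:(lia) ltac:(lia) ltac:(lia).
by move: IH1 IH0; rewrite /= negbK; case: (odd i) => -[h1 h2] [h3 h4]; split; lia.
Qed.

(** Here the chain runs [0, n, 1, n - 1, 2, ...] to its end. *)
Lemma rho_labelling (s : nat -> nat) n :
  2 <= n -> s 0 = 0 -> s n = 1 ->
  (forall i j, i <= n -> j <= n -> i <> j -> s i <> s j) ->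
  (forall i, i <= n -> near (s i) (s (n - i))) ->
  (forall i, 0 < i -> i.*2 <= n -> near (s i) (s (n.+1 - i))) ->
  forall i, i.*2 <= n -> s i = i.*2 /\ (i.*2 < n -> s (n - i) = i.*2.+1).
Proof.
move=> n2 s0 sn inj lo hi; elim=> [|i IHi] ilen; first by rewrite subn0.
have [|si] := IHi; first by lia.
move=> /(_ ltac:(lia)) sni.
have near1 := hi i.+1 isT ilen; have near2 := lo i.+1 ltac:(lia).
have e1 : n.+1 - i.+1 = n - i by lia.
rewrite e1 /near in near1; rewrite /near in near2.
have i1 := inj i.+1 i ltac:(lia) ltac:(lia) ltac:(lia).
have i2 := inj i.+1 (n - i) ltac:(lia) ltac:(lia) ltac:(lia).
have si1 : s i.+1 = i.+1.*2 by lia.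
split=> // lt_in.
have i3 := inj (n - i.+1) i.+1 ltac:(lia) ltac:(lia) ltac:(lia).
have i4 := inj (n - i.+1) (n - i) ltac:(lia) ltac:(lia) ltac:(lia).
lia.
Qed.

(** * Relabelling the distances *)

(** The last two clauses are what it means for the relabelled distance to be a
    path metric: the triangle inequality and the existence of geodesics, for one
    step of length [1]. *)
Record path_relabelling (V : eqType) (e : rel V) (s : nat -> nat) (a : nat) :
    Prop := PathRelabelling {
  relabel0 : s 0 = 0;
  pivot_occurs : occurs e a;
  relabel_pivot : s a = 1;
  relabel_inj : forall i j, occurs e i -> occurs e j -> s i = s j -> i = j;
  relabel_occurs : forall i, occurs e i -> occurs e (s i);
  relabel_onto : forall j, occurs e j -> exists i, occurs e i /\ s i = j;
  relabel_near : forall i j, realized e a i j -> near (s i) (s j);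
  relabel_next : forall i j,
    occurs e i -> occurs e j -> s j = (s i).+1 -> realized e a i j
}.

Section Relabelling.
Variables (V : eqType) (e : rel V) (x0 : V).
Hypotheses (ehom : metrically_homogeneous e) (egen : generic_type e x0).
Variables (s : nat -> nat) (a : nat).
Hypothesis srel : path_relabelling e s a.

Local Notation T := (realized e).
Local Notation occ := (occurs e).

Let s0 := relabel0 srel.
Let occ_a := pivot_occurs srel.
Let sa := relabel_pivot srel.
Let s_inj := relabel_inj srel.
Let s_occ := relabel_occurs srel.
Let s_onto := relabel_onto srel.
Let s_near := relabel_near srel.
Let s_next := relabel_next srel.
Let le_occ := occurs_le ehom.
Let sym := realizedC23 ehom.

Let geodesic i j k : occ k -> k = i + j -> T i k j.
Proof. by move=> occk E; move: occk; rewrite E; apply: realized_geodesic. Qed.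

Lemma s_neq i j : occ i -> occ j -> i <> j -> s i <> s j.
Proof. by move=> oi oj ij /s_inj; auto. Qed.

(** The labels of [x] and of the distances tied to it are among three consecutive
    integers. *)
Lemma crowded x l : occ x -> (forall y, y \in l -> y = x \/ T a x y) ->
  uniq l -> size l <= 3.
Proof.
move=> ox tied ul.
have occ_near y : y \in l -> occ y /\ near (s x) (s y).
  move=> /tied[->|t]; first by rewrite /near.
  by have [_ _ oy] := realized_occurs t; split=> //; apply: s_near.
rewrite -(size_map s) -(size_iota (s x).-1 3); apply: uniq_leq_size.
  rewrite map_inj_in_uniq // => y z /occ_near[oy _] /occ_near[oz _].
  exact: s_inj.
by move=> _ /mapP[y /occ_near[_ nxy] ->]; rewrite mem_iota; case: nxy; lia.
Qed.

Lemma crowded3 x y1 y2 y3 :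
  T a x y1 -> T a x y2 -> T a x y3 -> ~~ uniq [:: x; y1; y2; y3].
Proof.
move=> t1 t2 t3; have [_ ox _] := realized_occurs t1.
apply: contraT => /negbNE /(crowded ox) H; apply: H => y.
by rewrite !inE => /or4P[]/eqP->; auto.
Qed.

Lemma crowded4 x y1 y2 y3 y4 :
  T a x y1 -> T a x y2 -> T a x y3 -> T a x y4 -> ~~ uniq [:: y1; y2; y3; y4].
Proof.
move=> t1 t2 t3 t4; have [_ ox _] := realized_occurs t1.
apply: contraT => /negbNE /(crowded ox) H; apply: H => y.
by rewrite !inE => /or4P[]/eqP->; auto.
Qed.

Lemma no_triangle_of_ties x y z :
  T a x y -> T a x z -> T a y z -> ~~ uniq [:: x; y; z].
Proof.
move=> txy txz tyz; apply/negP; rewrite /= !inE => U.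
have [_ ox oy] := realized_occurs txy; have [_ _ oz] := realized_occurs tyz.
have nxy := s_neq ox oy ltac:(lia); have nxz := s_neq ox oz ltac:(lia).
have nyz := s_neq oy oz ltac:(lia).
have h1 := s_near txy; have h2 := s_near txz; have h3 := s_near tyz.
by rewrite /near in h1 h2 h3; lia.
Qed.

Lemma inner_neighbors x : occ x -> 0 < s x -> occ (s x).+1 ->
  exists y z, [/\ T a x y, T a x z, s y = (s x).-1 & s z = (s x).+1].
Proof.
move=> ox sx0 osx; have [z [oz sz]] := s_onto osx.
have [y [oy sy]] := s_onto (le_occ (leq_pred _) (s_occ ox)).
exists y, z; split=> //; last exact: s_next.
by apply/sym/s_next => //; lia.
Qed.

Lemma tie_complement i : i <= a -> T a i (a - i).
Proof. by move=> ia; apply: (realizedC12 ehom); apply: geodesic => //; lia. Qed.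

(** The distances [1], [a + 1], [3], [a - 1] would be tied in a cycle, which
    degenerates to a triangle when [a = 4]. *)
Lemma not_inner_pivot : 3 <= a -> ~ occ a.+2.
Proof.
move=> a3 oa2; have oa1 : occ a.+1 by apply: le_occ oa2.
have t20 : T a 2 (a - 2) by apply: tie_complement; lia.
have t2a : T a 2 a by apply/sym/(realized_ii2 ehom egen) => //; lia.
have t22 : T a 2 a.+2 by apply/sym/geodesic => //; lia.
have t10 : T a 1 (a - 1) by apply: tie_complement; lia.
have t12 : T a 1 a.+1 by apply/sym/geodesic => //; lia.
have t32 : T a 3 a.+1.
  have [|/sym//] := realized_succ ehom egen (ltac:(lia) : 0 < a) oa2.
  by move=> /sym t; move: (crowded4 t20 t2a t22 t); rewrite /= !inE; lia.
have t30 : T a 3 (a - 1).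
  have -> : a - 1 = a.-1 by lia.
  have oa1' : occ a.-1.+2 by have -> : a.-1.+2 = a.+1 by lia.
  have := realized_succ ehom egen (ltac:(lia) : 0 < a.-1) oa1'.
  rewrite prednK; last by lia.
  move=> [] /(realizedC12 ehom)/sym // t.
  by move: (crowded4 t20 t2a t22 t); rewrite /= !inE; lia.
have o1 : occ 1 by apply: le_occ oa2.
have o3 : occ 3 by apply: le_occ oa2; lia.
have om : occ (a - 1) by apply: le_occ oa2; lia.
case: (eqVneq 3 (a - 1)) => [E|/eqP E].
  rewrite -E in t10; have := no_triangle_of_ties t10 t12 t32.
  by rewrite /= !inE; lia.
have h1 := s_near t10; have h2 := s_near t12.
have h3 := s_near t30; have h4 := s_near t32.
have := s_neq o1 o3 ltac:(lia); have := s_neq om oa1 ltac:(lia).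
have := s_neq o1 oa1 ltac:(lia); have := s_neq o3 oa1 ltac:(lia).
have := s_neq o1 om ltac:(lia); have := s_neq o3 om E.
by rewrite /near in h1 h2 h3 h4; lia.
Qed.

(** An inner member of the chain is tied to both of its neighbours there. *)
Lemma chain_end x k : occ x -> 0 < s x ->
  (forall y, T a x y -> y = x \/ y = k) -> ~ occ (s x).+1.
Proof.
move=> ox sx0 only osx; have [y [z [ty tz sy sz]]] := inner_neighbors ox sx0 osx.
case: (only _ ty) (only _ tz) => E1 [] E2; subst; lia.
Qed.

Lemma s_gt0 i : occ i -> 0 < i -> 0 < s i.
Proof.
move=> oi i0; rewrite lt0n; apply/eqP; rewrite -s0.
by apply: s_neq => //; [apply: le_occ oi|lia].
Qed.

(** * The pivot [2] *)

Section PivotTwo.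
Hypotheses (a2 : a = 2) (occ4 : occ 4).

Let up i : occ i.+2 -> T a i i.+2.
Proof. by move=> oi; apply/sym/geodesic => //; lia. Qed.

(** The chain starts [0, 2, 4, ...]: each even number is tied to the next one. *)
Lemma pivot2_even i : occ i.*2 -> s i.*2 = i.
Proof.
elim/ltn_ind: i => -[|[|i]] IH oi; [exact: s0|by move: sa; rewrite a2|].
have oi1 : occ i.+1.*2 by apply: le_occ oi; lia.
have oi0 : occ i.*2 by apply: le_occ oi; lia.
have IH1 := IH i.+1 ltac:(lia) oi1; have IH0 := IH i ltac:(lia) oi0.
have := s_near (up oi : T a i.+1.*2 i.+2.*2).
have := s_neq oi oi0 ltac:(lia); have := s_neq oi oi1 ltac:(lia).
by rewrite /near; lia.
Qed.

(** The distance [1] ends the chain: apart from itself only [3] can be tied to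
    it, since [2] is already tied to [0], [2] and [4]. *)
Lemma pivot2_one : ~ occ (s 1).+1.
Proof.
have o1 : occ 1 by apply: le_occ occ4.
apply: (@chain_end 1 3) => //; first exact: s_gt0.
move=> y t; have := realized_triangle ehom t => b.
have ny2 : y <> 2.
  move=> E; move: t; rewrite E => /sym t21.
  have t20 : T a 2 0 by have := @tie_complement 2; rewrite a2; apply.
  have t22 : T a 2 2.
    rewrite a2; apply: (realized_ii2 ehom egen) => //; exact: le_occ occ4.
  by have := crowded4 t20 t21 t22 (up occ4).
lia.
Qed.

(** From its end at [1] the chain is read backwards as [1, 3, 5, ...]. *)
Lemma pivot2_odd n i : (forall j, occ j <-> j <= n) -> i.*2.+1 <= n ->
  s i.*2.+1 = n - i.
Proof.
move=> occn; have bnd j : j <= n -> s j <= n by move=> /occn/s_occ/occn.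
have s1 : s 1 = n.
  by have := pivot2_one; have := bnd 1; rewrite occn; have /occn := occ4; lia.
elim/ltn_ind: i => -[|i] IH oi; first by rewrite s1 subn0.
have IH1 := IH i (ltnSn _) ltac:(lia).
have oi' : occ i.*2.+3 by apply/occn; lia.
have := s_near (up oi'); have := bnd i.*2.+3 ltac:(lia).
have := s_neq oi' (le_occ _ oi' : occ i.*2.+1) ltac:(lia).
have ne : i = 0 \/ s i.*2.+3 <> n - i.-1.
  case: i IH {oi IH1} oi' => [|i] IH oi'; [by left|right].
  have <- := IH i ltac:(lia) ltac:(have /occn := oi'; lia).
  by apply: s_neq => //; [apply: le_occ oi'; lia|lia].
rewrite IH1 /near doubleS; move: oi; case: ne => [->|]; lia.
Qed.

End PivotTwo.

(** * The pivots [n.-1] and [n] *)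

(** Pushing outwards, a tie of [i] to [a + 2 - i] leaves three candidates for a
    distance tied to [i + 1]. Two of them, [a + 2 - i] and [a + 3 - i], are already
    tied to two others. For [i = 2] the second of these is [a + 1], which has no
    complement in [a]; hence the separate hypothesis on [3]. *)
Lemma upper_ties : T a 2 a -> (6 <= a.+1 -> T a 3 (a - 1)) ->
  forall i, 2 <= i -> i.*2 <= a.+1 -> T a i (a.+2 - i).
Proof.
move=> t2 t3; elim/ltn_ind => -[|[|[|[|i]]]] // IH _ ia.
  by rewrite subSS subSS subn0.
have IH1 := IH i.+3 ltac:(lia) isT ltac:(lia).
have IH0 := IH i.+2 ltac:(lia) isT ltac:(lia).
have oi : occ i.+4 by apply: le_occ occ_a; lia.
have [k [tk kb]] := realized_step ehom IH1 oi.
have tk' := sym tk.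
have [E|[E|E]] : k = a.+2 - i.+4 \/ k = a.+2 - i.+3 \/ k = a.+2 - i.+2 by lia.
- by rewrite -E.
- have lo : T a k i.+1.
    have -> : i.+1 = a - k by lia.
    by apply: tie_complement; lia.
  rewrite -E in IH1.
  by have := crowded3 lo (sym IH1) tk'; rewrite /= !inE; lia.
- have lo : T a k i.
    have -> : i = a - k by lia.
    by apply: tie_complement; lia.
  rewrite -E in IH0.
  by have := crowded3 lo (sym IH0) tk'; rewrite /= !inE; lia.
Qed.

Lemma tau_of_ties : 3 <= a -> T a 2 a -> (6 <= a.+1 -> T a 3 (a - 1)) ->
  s 1 = a -> (forall i, i <= a -> s i <= a) ->
  forall i, 0 < i <= a ->
    s i = if odd (minn i (a.+1 - i)) then a.+1 - i else i.
Proof.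
move=> a3 t2 t3 s1 sbnd i /andP[i0 ia].
have up := upper_ties t2 t3.
have lab : forall j, 0 < j -> j.*2 <= a.+1 ->
    if odd j then s j = a.+1 - j /\ s (a.+1 - j) = j
    else s j = j /\ s (a.+1 - j) = a.+1 - j.
  apply: tau_labelling => //; first exact: ltnW.
  - by move=> j k ja ka; apply: s_neq; apply: le_occ occ_a.
  - by move=> j ja; apply/s_near/tie_complement.
  - by move=> j j2 ja; apply/s_near/up.
case: (leqP i.*2 a.+1) => [le_i|lt_i].
  have -> : minn i (a.+1 - i) = i by lia.
  by have := lab i i0 le_i; case: ifP => _ [].
have -> : minn i (a.+1 - i) = a.+1 - i by lia.
have := lab (a.+1 - i) ltac:(lia) ltac:(lia).
have -> : a.+1 - (a.+1 - i) = i by lia.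
by case: ifP => _ [].
Qed.

(** The distance [n] is tied to [1] only, hence it comes last and leaves to [1]
    the label [n.-1]; the rest of the chain looks as for a pivot at the diameter. *)
Lemma penultimate_pivot n : 4 <= n -> n = a.+1 -> (forall i, occ i <-> i <= n) ->
  forall i, 0 < i <= n -> s i = tau 0 n i.
Proof.
move=> n4 na occn; have bnd j : j <= n -> s j <= n by move=> /occn/s_occ/occn.
have o1 : occ 1 by apply/occn; lia.
have on : occ n by apply/occn.
have t20 : T a 2 (a - 2) by apply: tie_complement; lia.
have t2a : T a 2 a by apply/sym/(realized_ii2 ehom egen); [lia|rewrite -na].
have t1n : T a 1 n by apply/sym/geodesic => //; lia.
have t1 : T a 1 (a - 1) by apply: tie_complement; lia.
have ta0 : T a a 0 by have := @tie_complement a (leqnn _); rewrite subnn.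
have sn : s n = n.
  have := bnd n (leqnn _); rewrite leq_eqVlt => /orP[/eqP//|lt_sn].
  exfalso; apply: (@chain_end n 1) (_ : occ (s n).+1) => //.
  - by apply: s_gt0 => //; lia.
  - move=> k tk; have [_ _ /occn kn] := realized_occurs tk.
    have b := realized_triangle ehom tk.
    case: (eqVneq k n) => [|/eqP kn']; first by left.
    case: (eqVneq k 1) => [|/eqP k1]; first by right.
    exfalso; case: (eqVneq k a) => [E|/eqP ka].
      rewrite E in tk; have := crowded3 ta0 (sym t2a) (sym tk).
      by rewrite /= !inE; lia.
    case: (eqVneq k (a - 1)) => [E|/eqP ka1].
      rewrite -E in t1; have := no_triangle_of_ties t1n t1 tk.
      by rewrite /= !inE; lia.
    (* Pushed outwards, the tie of [k] and [n] becomes a tie of [k.+1] to [n],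
       already tied to [1] and [k], or to [n.-1], already tied to [0] and [2]. *)
    have ok1 : occ k.+1 by apply/occn; lia.
    have [k' [tk' k'b]] := realized_step ehom (sym tk) ok1.
    have [_ _ /occn k'n] := realized_occurs tk'.
    have [E|E] : k' = n \/ k' = a by lia.
      rewrite E in tk'; have := crowded3 (sym t1n) tk (sym tk').
      by rewrite /= !inE; lia.
    rewrite E in tk'; have := crowded3 ta0 (sym t2a) (sym tk').
    by rewrite /= !inE; lia.
  - by apply/occn.
have s1 : s 1 = a.
  have := s_near t1n; have := s_neq o1 on ltac:(lia).
  by have := bnd 1 ltac:(lia); rewrite /near sn; lia.
have lab := @tau_of_ties ltac:(lia) t2a _ s1 _.
move=> i /andP[i0 le_in]; rewrite /tau addn0.
case: (eqVneq i n) => [->|/eqP ne]; first by rewrite subnn minn0.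
rewrite na; apply: lab; last by lia.
- move=> n6; have oa : occ a.-1.+2 by apply/occn; lia.
  have := realized_succ ehom egen (ltac:(lia) : 0 < a.-1) oa.
  rewrite prednK -?subn1; last by lia.
  move=> [] /(realizedC12 ehom)/sym // t.
  by have := crowded3 t20 t2a t; rewrite /= !inE; lia.
- move=> j ja; have oj : occ j by apply/occn; lia.
  by have := bnd j ltac:(lia); have := s_neq oj on ltac:(lia); lia.
Qed.

(** The dichotomy is whether the last sphere has edges, that is, whether [1] is
    tied to [n]. If so, ties of [i] to [n + 1 - i] propagate from there. If not,
    [1] ends the chain, hence [2] is an inner member and tied to [n] or [n.-1],
    and by [not_realized_last] to [n] in either case. *)
Lemma last_pivot n : 4 <= n -> n = a -> (forall i, occ i <-> i <= n) ->
  (forall i, 0 < i <= n -> s i = rho n i) \/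
  (forall i, 0 < i <= n -> s i = tau 1 n i).
Proof.
move=> n4 na occn; have bnd j : j <= n -> s j <= n by move=> /occn/s_occ/occn.
have o1 : occ 1 by apply/occn; lia.
have o2 : occ 2 by apply/occn; lia.
have ta0 : T a a 0 by have := @tie_complement a (leqnn _); rewrite subnn.
have t1 : T a 1 (a - 1) by apply: tie_complement; lia.
have Tbnd x y : T a x y -> y <= a by move=> /realized_occurs[_ _ /occn]; rewrite na.
case: (pselect (T a 1 a)) => [t1a|not_t1a].
  left; have up i : 0 < i -> i.*2 <= n -> T a i (n.+1 - i).
    rewrite na; elim/ltn_ind: i => -[|[|i]] // IH _ ia; first by rewrite subn1.
    have IH1 := IH i.+1 (ltnSn _) isT ltac:(lia).
    have oi : occ i.+2 by apply/occn; lia.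
    have [k [tk kb]] := realized_step ehom IH1 oi.
    have ka := Tbnd _ _ tk; have tk' := sym tk.
    have [E|[E|E]] : k = a.+1 - i.+2 \/ k = a.+1 - i.+1 \/ k = a.+1 - i by lia.
    - by rewrite -E.
    - have lo : T a k i.
        have -> : i = a - k by lia.
        exact: tie_complement.
      rewrite -E in IH1.
      by have := crowded3 lo (sym IH1) tk'; rewrite /= !inE; lia.
    - have i0 : 0 < i by lia.
      have lo : T a k i.-1.
        have -> : i.-1 = a - k by lia.
        exact: tie_complement.
      have := IH i ltac:(lia) i0 ltac:(lia); rewrite -E => IH0.
      by have := crowded3 lo (sym IH0) tk'; rewrite /= !inE; lia.
  have lab i : i.*2 <= n -> s i = i.*2 /\ (i.*2 < n -> s (n - i) = i.*2.+1).
    apply: rho_labelling; rewrite ?s0 ?na ?sa //; first by lia.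
    - by move=> j k ja ka; apply: s_neq; apply: le_occ occ_a.
    - by move=> j ja; apply/s_near/tie_complement.
    - by move=> j j2 ja; rewrite -na; apply/s_near/up; rewrite // na.
  move=> i /andP[i0 le_in]; rewrite /rho; case: ifP => [le_i|gt_i].
    by have [|-> _] := lab i; lia.
  have [|_] := lab (n - i); first by lia.
  have -> : n - (n - i) = i by lia.
  by move=> ->; lia.
right.
have s1 : s 1 = n.
  have := bnd 1 ltac:(lia); rewrite leq_eqVlt => /orP[/eqP//|lt_s1].
  exfalso; apply: (@chain_end 1 (a - 1)) (_ : occ (s 1).+1) => //.
  - by apply: s_gt0.
  - move=> k tk; right; have := realized_triangle ehom tk; have := Tbnd _ _ tk.
    have : k <> a by move=> E; apply: not_t1a; rewrite -{2}E.
    lia.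
  - by apply/occn.
have t2a : T a 2 a.
  apply: contrapT => not_t2a; apply: (@chain_end 2 (a - 2)) (_ : occ (s 2).+1) => //.
  - by apply: s_gt0.
  - move=> k tk; right; have := realized_triangle ehom tk; have := Tbnd _ _ tk.
    have : k <> a by move=> E; apply: not_t2a; rewrite -{2}E.
    have : k <> a - 1.
      move=> E; have an1 : a - 1 = n.-1 by lia.
      apply: (not_realized_last ehom egen n4).
      + by move=> u v; apply/occn; exists u, v.
      + by rewrite na => /sym.
      + by rewrite na => /sym.
      + by apply/sym; rewrite -an1 -E {1}na.
    lia.
  - apply/occn; have := bnd 2 ltac:(lia); have := s_neq o1 o2 ltac:(lia); lia.
have lab := @tau_of_ties ltac:(lia) t2a _ _ _.
move=> i /andP[i0 le_in]; rewrite /tau addn1 na; apply: lab; rewrite -?na ?i0 //.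
- move=> n6; have o3 : occ 3 by apply/occn; lia.
  have [k [tk kb]] := realized_step ehom t2a o3; have ka := Tbnd _ _ tk.
  have [E|E] : k = a \/ k = a - 1 by lia.
    rewrite E in tk; have := crowded3 ta0 (sym t2a) (sym tk).
    by rewrite /= !inE; lia.
  by rewrite na -E.
Qed.

End Relabelling.

(** * The classification *)

Definition agree (n : nat) (s t : nat -> nat) :=
  forall i, 0 < i <= n -> s i = t i.

(** In this range every permutation that moves [1] is one of the four. *)
Lemma small_diameter n (s : nat -> nat) :
  0 < n <= 3 -> (forall i, 0 < i <= n -> 0 < s i <= n) ->
  (forall i j, 0 < i <= n -> 0 < j <= n -> i <> j -> s i <> s j) ->
  s 1 <> 1 ->
  [\/ agree n s (rho n), agree n s (rho_inv n), agree n s (tau 0 n) |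
      agree n s (tau 1 n)].
Proof.
move=> n3 bnd inj s1.
have b1 := bnd 1; have b2 := bnd 2; have b3 := bnd 3.
have n12 := inj 1 2; have n13 := inj 1 3; have n23 := inj 2 3.
have [E|E] : n = 2 \/ n = 3 by lia.
- subst n; have [E1 E2] : s 1 = 2 /\ s 2 = 1 by lia.
  by apply: Or41 => j jb; have [->|->] : j = 1 \/ j = 2 by lia.
- subst n; have agreeE t :
      t 1 = s 1 -> t 2 = s 2 -> t 3 = s 3 -> agree 3 s t.
    move=> t1 t2 t3 j jb.
    by have [->|[->|->]] : j = 1 \/ j = 2 \/ j = 3 by lia.
  have [[E1 [E2 E3]]|[[E1 [E2 E3]]|[[E1 [E2 E3]]|[E1 [E2 E3]]]]] :
    (s 1 = 2 /\ s 2 = 3 /\ s 3 = 1) \/ (s 1 = 3 /\ s 2 = 1 /\ s 3 = 2) \/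
    (s 1 = 2 /\ s 2 = 1 /\ s 3 = 3) \/ (s 1 = 3 /\ s 2 = 2 /\ s 3 = 1) by lia.
  + by apply/Or41/agreeE; rewrite ?E1 ?E2 ?E3.
  + by apply/Or42/agreeE; rewrite ?E1 ?E2 ?E3.
  + by apply/Or43/agreeE; rewrite ?E1 ?E2 ?E3.
  + by apply/Or44/agreeE; rewrite ?E1 ?E2 ?E3.
Qed.

Theorem theorem1 (V : eqType) (e : rel V) (x0 : V) (delta : option nat)
    (sigma : nat -> nat)
    (he : metrically_homogeneous e)
    (hgen : generic_type e x0)
    (hdelta : has_diameter e delta)
    (hsigma : language_permutation delta sigma)
    (hnontriv : nontrivial_on delta sigma)
    (htwist : twist_metrically_homogeneous e sigma) :
  exists n : nat, delta = Some n /\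
    [\/ same_on delta sigma (rho n),
        same_on delta sigma (rho_inv n),
        same_on delta sigma (tau 0 n) |
        same_on delta sigma (tau 1 n)].
Proof.
have [esimple econn _] := he.
have [tconn tdist [tsimple _ _]] := htwist.
have [smaps sinj sonto] := hsigma.
pose s i := if i == 0 then 0 else sigma i.
have sE i : 0 < i -> s i = sigma i by rewrite /s lt0n => /negbTE ->.
have twE u v : gdist (twist_edge e sigma) u v = s (gdist e u v).
  rewrite -tdist /twist_dist /s; case: eqP => [->|ne]; first by rewrite gdistxx.
  by case: eqP => // /(gdist_eq0 econn).
have occ_lang i : occurs e i <-> i = 0 \/ language delta i.
  case: delta hdelta {hsigma hnontriv smaps sinj sonto} => [n|] /=.
    move=> [bnd [u [v uvn]]]; split.
      by move=> [x [y <-]]; have := bnd x y; rewrite /language /=; lia.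
    move=> oi; apply: (occurs_le he) (_ : occurs e n); last by exists u, v.
    by case: oi; rewrite /language /=; lia.
  move=> unbnd; split=> [_|_]; first by rewrite /language /=; lia.
  have [u [v uvi]] := unbnd i.
  by apply: (occurs_le he) (ltnW uvi) _; exists u, v.
have s0 : s 0 = 0 by [].
have lang_s i : language delta i -> language delta (s i).
  by move=> li; rewrite sE; [exact: smaps|case: li].
have s_occ i : occurs e i -> occurs e (s i).
  by rewrite !occ_lang => -[->|/lang_s]; auto.
have s_inj i j : occurs e i -> occurs e j -> s i = s j -> i = j.
  rewrite !occ_lang => -[->|li] [->|lj] //.
  - by move=> E; have [] := lang_s _ lj; rewrite -E.
  - by move=> E; have [] := lang_s _ li; rewrite E.
  - by rewrite !sE; [apply: sinj; apply/mem_set|case: lj|case: li].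
have s_onto j : occurs e j -> exists i, occurs e i /\ s i = j.
  rewrite occ_lang => -[->|/sonto[i li <-]]; first by exists 0; rewrite occ_lang; auto.
  by exists i; rewrite occ_lang sE; [auto|case: li].
have [i0 [li0 si0]] := hnontriv.
have occ1 : occurs e 1.
  by apply: (occurs_le he) (_ : occurs e i0); [case: li0|rewrite occ_lang; auto].
have [a [occ_a sa]] := s_onto 1 occ1.
have s_near i j : realized e a i j -> near (s i) (s j).
  move=> [u [v [w [uv uw vw]]]].
  have := gdist_triangles tsimple tconn u v w.
  by rewrite !twE uv uw vw sa /near; lia.
have s_next i j : occurs e i -> occurs e j -> s j = (s i).+1 -> realized e a i j.
  move=> oi [u [v uv]] sj.
  have [|w [uw wv]] := @gdist_split _ _ tconn u v (s i) 1.
    by rewrite twE uv; lia.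
  rewrite twE in uw; rewrite twE in wv.
  exists w, v, u; rewrite !(gdistC esimple econn _ u); split=> //.
    by apply: s_inj; rewrite ?sa //; exists w, v.
  by apply: s_inj => //; exists u, w.
have srel : path_relabelling e s a by [].
have le_occ i j : i <= j -> occurs e j -> occurs e i by apply: occurs_le.
have s_neq i j : occurs e i -> occurs e j -> i <> j -> s i <> s j.
  by move=> oi oj ij /s_inj; auto.
have a0 : a <> 0 by move=> E; move: sa; rewrite E.
(* With pivot [1] the twist keeps the edges, hence the distances. *)
have a1 : a <> 1.
  move=> E; apply: si0; rewrite -sE; last by case: li0.
  have : occurs e i0 by rewrite occ_lang; auto.
  elim/ltn_ind: i0 {li0} => -[|[|i]] // IH oi;
    first by move: sa; rewrite E.
  have oi1 := le_occ _ _ (leqnSn _) oi; have oi0 := le_occ _ _ (leqnSn _) oi1.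
  have := s_near i.+1 i.+2; rewrite /near E => /(_ _)[].
    by apply: (realizedC23 he); apply: (@realized_geodesic _ _ he 1 i.+1).
  have := IH i.+1 (ltnSn _) oi1; have := IH i ltac:(lia) oi0.
  have := s_neq _ _ oi oi1 ltac:(lia); have := s_neq _ _ oi oi0 ltac:(lia).
  lia.
have finite : exists n, delta = Some n.
  case: delta hdelta occ_lang {hsigma hnontriv smaps sinj sonto li0 lang_s}
    => [n|] hdelta occ_lang; first by exists n.
  exfalso; have all_occ i : occurs e i.
    by rewrite occ_lang /language /=; lia.
  have [E|a3] : a = 2 \/ 3 <= a by lia.
    by apply: (pivot2_one he hgen srel).
  by apply: (not_inner_pivot he hgen srel).
have [n dn] := finite; exists n; split=> //.
have occn i : occurs e i <-> i <= n.
  by rewrite occ_lang dn /language /=; lia.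
have an : 0 < a <= n by have /occn := occ_a; lia.
have from_agree t : agree n s t -> same_on delta sigma t.
  rewrite dn => st i [i0' le_in]; rewrite -sE //; apply: st; lia.
suff : [\/ agree n s (rho n), agree n s (rho_inv n), agree n s (tau 0 n) |
          agree n s (tau 1 n)].
  by case=> /from_agree H; [apply: Or41|apply: Or42|apply: Or43|apply: Or44].
have [n3|n4] := leqP n 3.
  apply: small_diameter => //; first by lia.
  - move=> i ib; have oi : occurs e i by apply/occn; lia.
    have /occn := s_occ _ oi; have := s_neq i 0 oi; rewrite occn s0; lia.
  - by move=> i j ib jb; apply: s_neq; apply/occn; lia.
  - by move=> s1; apply: a1; apply: s_inj; rewrite ?s1.
have occ4 : occurs e 4 by apply/occn.
have [a2|a3] : a = 2 \/ 3 <= a by lia.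
  apply: Or42 => i ib; rewrite /rho_inv.
  have oi : occurs e i by apply/occn; lia.
  case: ifP => [odd_i|even_i].
    have E : i = (i %/ 2).*2.+1 by lia.
    have -> : (i - 1) %/ 2 = i %/ 2 by lia.
    by rewrite {1}E; apply: (pivot2_odd he hgen srel) => //; lia.
  have E : i = (i %/ 2).*2 by lia.
  by rewrite {1}E; apply: (pivot2_even he srel) => //; rewrite -E.
have : ~ occurs e a.+2 by apply: (not_inner_pivot he hgen srel).
rewrite occn => an2.
have [E|E] : n = a.+1 \/ n = a by lia.
  by apply: Or43; apply: (penultimate_pivot he hgen srel).
have [H|H] := last_pivot he hgen srel n4 E occn; [exact: Or41|exact: Or44].
Qed.
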